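(* Assume $2^{<\mathfrak{c}} = \mathfrak{c}$. Let $X$ be a $T_2$ sequential almost discretely Lindelöf space such that $\psi(X) \leq \mathfrak{c}$. Then $|X| \leq \mathfrak{c}$.
   Context: $\mathfrak{c} = 2^{\aleph_0}$ is the cardinality of the continuum, and $2^{<\mathfrak{c}} = \sup\{2^{\lambda} : \lambda < \mathfrak{c},\ \lambda \text{ a cardinal}\}$. A space $X$ is almost discretely Lindelöf if for every discrete subset $D \subset X$ (i.e. $D$ is discrete in the subspace topology) there is a Lindelöf subspace $L$ of $X$ such that $D \subset L$. ''Lindelöf'' means that every open cover has a countable subcover. A space is sequential if every non-closed set contains a sequence converging to a point outside of it. For a point $x \in X$, $\psi(x,X)$ is the minimum cardinal $\kappa$ such that $\{x\}$ is the intersection of $\kappa$ many open sets, and the pseudocharacter of $X$ is $\psi(X) = \sup\{\psi(x,X) : x \in X\}$. *)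

(* Defs.v *)
From mathcomp Require Import all_boot all_classical.
From mathcomp Require Import topology.

Set Implicit Arguments.
Unset Strict Implicit.
Unset Printing Implicit Defensive.

Local Open Scope classical_set_scope.
Local Open Scope card_scope.

(** Cardinals are represented by types, up to the relations [#=] and [#<=]
    between full sets. Extremal cardinals are accordingly given by predicates
    that determine a type up to equipotence. *)

Definition card_lt (K L : Type) : Prop :=
  [set: K] #<= [set: L] /\ ~ ([set: K] #= [set: L]).

Definition is_card_min (S : Type -> Prop) (K : Type) : Prop :=
  S K /\ forall L, S L -> [set: K] #<= [set: L].

Definition is_card_sup (S : Type -> Prop) (K : Type) : Prop :=
  (forall L, S L -> [set: L] #<= [set: K]) /\
  (forall M, (forall L, S L -> [set: L] #<= [set: M]) -> [set: K] #<= [set: M]).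

(** 2 ^ aleph_0, as the power set of [nat] *)
Definition continuum : Type := set nat.

(** [is_weak_power K M] : M = 2 ^ (< K) *)
Definition is_weak_power (K M : Type) : Prop :=
  is_card_sup
    (fun P => exists2 L : Type, card_lt L K & [set: P] #= [set: set L]) M.

Definition lindelof_space (T : topologicalType) : Prop :=
  forall C : set (set T), C `<=` open -> \bigcup_(U in C) U = [set: T] ->
  exists C' : set (set T),
    [/\ C' `<=` C, countable C' & \bigcup_(U in C') U = [set: T]].

Definition discrete_space (T : topologicalType) : Prop :=
  forall A : set T, open A.

(** A subset used as a type carries the topology induced by the ambient space
    (subtype_topology.v). *)
Definition almost_discretely_lindelof (X : topologicalType) : Prop :=
  forall D : set X, discrete_space D ->
  exists2 L : set X, lindelof_space L & D `<=` L.

Definition sequential_space (X : topologicalType) : Prop :=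
  forall A : set X, ~ closed A ->
  exists (u : nat -> X) (x : X), [/\ forall n, A (u n), ~ A x & u @ \oo --> x].

(** [is_point_pseudocharacter x K] : K = psi(x, X) *)
Definition is_point_pseudocharacter (X : topologicalType) (x : X) (K : Type) :
    Prop :=
  is_card_min
    (fun L => exists2 U : L -> set X, forall i, open (U i) &
              \bigcap_i U i = [set x]) K.

(** [is_pseudocharacter X K] : K = psi(X) *)
Definition is_pseudocharacter (X : topologicalType) (K : Type) : Prop :=
  is_card_sup (fun L => exists x : X, is_point_pseudocharacter x L) K.

(* Main.v *)
Require Import Defs.
From mathcomp Require Import all_boot all_classical.
From mathcomp Require Import topology.

Set Implicit Arguments.
Unset Strict Implicit.
Unset Printing Implicit Defensive.

Local Open Scope classical_set_scope.
Local Open Scope card_scope.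

(** Call a set small when its cardinality is less than that of the continuum
    [c]. From [2 ^ (< c) = c] two facts of cardinal arithmetic follow: a union
    of fewer than [c] small sets has fewer than [c] elements ([c] is regular,
    [small_bigcup]), and a set of cardinality [c] has only [c] small subsets
    ([card_small_subsets]).

    Fix, for each point [x], a family [B x] of at most [c] open sets with
    intersection [{x}]. Because there are only [c] small sets of indices, a
    closing-off argument yields a set [Y], enumerated by [c], which contains
    the limits of its convergent sequences and is saturated: if a small part
    [A] of [Y], with one member of [B a] for each [a] in [A], is such that
    [closure A] and the chosen open sets cover [Y], then they cover [X]
    ([exists_saturated_range]). Since [X] is sequential, [Y] is closed.

    Then [Y] is all of [X]. Otherwise let [p] lie outside [Y] and choose for
    each [y] in [Y] a member [U y] of [B y] that misses [p]. For a small part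
    [A] of [Y], neither [closure A] (contained in [Y]) nor the sets [U a]
    contain [p]; by saturation they do not cover [Y]. This contradicts
    [small_shadow_cover]: picking one uncovered point of [Y] after another,
    along a well-order of [c] all of whose initial segments are small, and
    taking into [A] at each step both the previous picks and the previous
    points of the enumeration of [Y], one obtains a discrete set of points. It
    lies in a Lindelof subspace, which is covered by the sets [U y] and the
    complement of the closed set [Y]; so countably many sets [U y] cover the
    picked points. But [c] has uncountable cofinality, so all of these [y] are
    enumerated before some step, and the point picked there is in none of the
    [U y]. *)

(** * Comparison of cardinals *)

Lemma card_le_injective (T U : Type) (B : set U) :
  [set: T] #<= B -> exists2 g : T -> U, injective g & forall t, B (g t).
Proof.
move=> /card_leP[f]; have finj : injective f.
  by move=> x y; apply: inj; rewrite inE.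
exists (fun t => val (f (to_setT t))).
  by move=> x y /val_inj /finj /(congr1 val).
by move=> t; apply: set_mem; exact: valP.
Qed.

Lemma injective_card_le (T U : Type) (A : set T) (B : set U) (f : T -> U) :
  (forall t, A t -> B (f t)) ->
  (forall s t, A s -> A t -> f s = f t -> s = t) -> A #<= B.
Proof.
move=> fAB finj; have [g] : $|{injfun A >-> B}|.
  by apply/injfunPex; exists f => // s t /set_mem As /set_mem At; exact: finj.
exact: inj_card_le.
Qed.

(** When [U] is empty there is no function from [T] to [U] to take images by,
    hence the case distinction and the detour through the type of [A]. *)
Lemma card_le_set (T U : Type) (A : set T) :
  A #<= [set: U] -> [set K | K `<=` A] #<= [set: set U].
Proof.
case: (pselect (exists u : U, True)) => [[u _]|noU] AU; last first.
  have UE : [set: U] = set0.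
    by apply/seteqP; split => // u _; apply: noU; exists u.
  move: AU; rewrite UE => /card_le0P ->.
  apply: (@injective_card_le _ _ _ _ (fun=> set0)) => // K L.
  by rewrite /= !subset0 => -> ->.
have /card_le_injective[g ginj _] : [set: set_type A] #<= [set: U].
  by rewrite (card_le_eql (card_setT A)).
pose h (K : set T) := [set g a | a in [set a : set_type A | K (val a)]].
have hE (K : set T) (a : set_type A) : h K (g a) <-> K (val a).
  by split=> [[b Kb /ginj <-]|Ka] //; exists a.
apply: (@injective_card_le _ _ _ _ h) => // K L KA LA KL.
apply/seteqP; split => t Kt.
  have tA : t \in A by apply/mem_set/KA.
  by apply: (iffLR (hE L (exist _ t tA))); rewrite -KL; apply/hE.
have tA : t \in A by apply/mem_set/LA.
by apply: (iffLR (hE K (exist _ t tA))); rewrite KL; apply/hE.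
Qed.

(** Hoenig's argument: take a maximal set of tuples, in the product of the
    [K i], on which all projections are injective. Some projection is onto,
    for otherwise a tuple made of values missed by each projection could be
    added. Reading the other coordinates of a tuple off its [i]-th one gives
    the injections. *)
Lemma exists_least_card (I : Type) (i0 : I) (K : I -> Type) :
  exists i, forall j, [set: K i] #<= [set: K j].
Proof.
pose inj_proj (M : set (forall i, K i)) :=
  forall i f g, M f -> M g -> f i = g i -> f = g.
have [F FP Ftot|M [Minj Mmax]] := @Zorn_bigcup _ inj_proj.
  move=> i f g [A FA Af] [B FB Bg]; case: (Ftot A B FA FB) => [AB|BA].
    by apply: (FP B FB) => //; exact: AB.
  by apply: (FP A FA) => //; exact: BA.
have [i Mi] : exists i, forall x, exists2 f, M f & f i = x.
  apply: contrapT => /forallNP noi.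
  have missed i : exists x, forall g, M g -> g i <> x.
    have /existsNP[x Mx] := noi i; exists x => g Mg gx.
    by apply: Mx; exists g.
  pose f i := sval (cid (missed i)).
  have fM i g : M g -> g i <> f i by rewrite /f; case: cid => x /= /(_ g).
  apply: (Mmax (M `|` [set f])).
    split=> [|MfM]; first exact: subsetUl.
    by have /fM/(_ erefl) := MfM f (or_intror erefl); apply.
  move=> i g h [Mg|->] [Mh|->] gh //; first exact: (Minj i).
    by case: (fM i g Mg).
  by case: (fM i h Mh).
have /choice[lift liftP] : forall x : K i, exists f, M f /\ f i = x.
  by move=> x; have [f Mf <-] := Mi x; exists f.
exists i => j.
apply: (@injective_card_le _ _ _ _ (fun x => lift x j)) => // x y _ _ xy.
have [Mx <-] := liftP x; have [My <-] := liftP y.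
by rewrite (Minj j _ _ Mx My xy).
Qed.

Lemma card_le_total (A B : Type) :
  [set: A] #<= [set: B] \/ [set: B] #<= [set: A].
Proof.
have [[] /=] := exists_least_card true (fun b : bool => if b then A else B).
  by move/(_ false); left.
by move/(_ true); right.
Qed.

(** Initial ordinals, without ordinals: well-order [T], and if some initial
    segment is as large as [T], pull the order back along an injection of [T]
    into the first such segment. *)
Lemma exists_initial_order (T : Type) :
  exists lt : T -> T -> Prop,
    [/\ well_founded lt, forall x y, [\/ lt x y, x = y | lt y x] &
        forall x, ~~ ([set: T] #<= [set y | lt y x])].
Proof.
case: (pselect (exists t : T, True)) => [[t0 _]|noT]; last first.
  by exists (fun _ _ => True); split=> [x|x|x]; case: noT; exists x.
elim/Peq : T t0 => T t0.
have [R Rwo] := wochoice.well_ordering_principle T.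
have Rmin (A : set T) : A !=set0 -> exists2 m, A m & forall x, A x -> R m x.
  move=> [a Aa].
  have [|m [[mA mmin] _]] := Rwo (mem A); first by exists a; exact: mem_set.
  by exists m => [|x Ax]; [exact: set_mem | apply: mmin; exact: mem_set].
have Rtot x y : R x y || R y x.
  have [m mxy mmin] := Rmin [set x; y] (ex_intro _ x (or_introl erefl)).
  by case: mxy mmin => -> mmin; apply/orP; [left|right]; apply: mmin;
    [right|left].
have Ranti x y : R x y -> R y x -> x = y.
  move=> xy yx; have [|m [_ muniq]] := Rwo (mem [set x; y]).
    by exists x; apply: mem_set; left.
  have Rxx z : R z z by have := Rtot z z; rewrite orbb.
  by rewrite -(muniq x) ?(muniq y) //; split; rewrite ?inE; [right| |left|];
    move=> // z /set_mem[] ->.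
(* [f] maps [T] into the first segment equipotent to it, if there is one *)
have [f finj fsmall] : exists2 f : T -> T, injective f &
    forall x, ~~ ([set: T] #<= [set y | ~~ R (f x) y]).
  case: (pselect (exists a, [set: T] #<= [set y | ~~ R a y])) => [ex|noa].
    have [a Ta amin] := Rmin [set a | [set: T] #<= [set y | ~~ R a y]] ex.
    have [f finj fa] := card_le_injective Ta; exists f => // x.
    by apply/negP => /amin; apply/negP; exact: fa.
  by exists id => // x; apply/negP => Tx; apply: noa; exists x.
exists (fun x y => ~~ R (f y) (f x)); split=> [x|x y|x].
- apply: contrapT => nx.
  have [|m [y [ny <-]] ymin] := Rmin [set z | exists y,
      ~ Acc (fun x y => ~~ R (f y) (f x)) y /\ f y = z].
    by exists (f x), x.
  apply: ny; constructor => z /negP zy; apply: contrapT => nz.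
  by apply: zy; apply: ymin; exists z.
- case xy: (R (f x) (f y)); last by apply: Or33.
  case yx: (R (f y) (f x)); last by apply: Or31.
  by apply: Or32; apply: finj; exact: Ranti.
- apply: contra (fsmall x) => Tx; apply: card_le_trans Tx _.
  by apply: (@injective_card_le _ _ _ _ f) => // y z _ _; exact: finj.
Qed.

(** The relation [P a f] may look only at the values of [f] below [a], so that
    it is enough to choose against an approximation of [f] that is correct
    there. *)
Lemma well_founded_choice (A B : Type) (lt : A -> A -> Prop)
    (P : A -> (A -> B) -> B -> Prop) (b0 : B) :
  well_founded lt ->
  (forall a f g b, (forall c, lt c a -> f c = g c) -> P a f b -> P a g b) ->
  (forall a f, exists b, P a f b) ->
  exists f, forall a, P a f (f a).
Proof.
move=> wf Pext Pex; pose F a f := sval (cid (Pex a f)).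
have FP a f : P a f (F a f) by rewrite /F; case: cid.
pose cut a (rec : forall c, lt c a -> B) c :=
  if pselect (lt c a) is left h then rec c h else b0.
pose f := Fix wf (fun=> B) (fun a rec => F a (@cut a rec)).
have fE a : f a = F a (cut a (fun c _ => f c)).
  rewrite /f Fix_eq // => x g h gh; congr (F _ (cut _ _)).
  apply/functional_extensionality_dep => c.
  exact/functional_extensionality_dep.
exists f => a; rewrite [f a in X in P _ _ X]fE; apply: Pext (FP _ _) => c ca.
by rewrite /cut; case: pselect.
Qed.

(** * Small sets *)

Definition small (T : Type) (A : set T) : Prop := ~~ ([set: continuum] #<= A).

Lemma small_card_le (T U : Type) (A : set T) (B : set U) :
  A #<= B -> small B -> small A.
Proof. by move=> AB; apply: contra => /card_le_trans; apply. Qed.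

Lemma small_subset (T : Type) (A B : set T) : A `<=` B -> small B -> small A.
Proof. by move=> AB; apply: small_card_le; exact: subset_card_le. Qed.

Lemma small_image (T U : Type) (f : T -> U) (A : set T) :
  small A -> small (f @` A).
Proof. by apply: small_card_le; exact: card_image_le. Qed.

Lemma not_small_continuum : ~ small [set: continuum].
Proof. by rewrite /small card_lexx. Qed.

Lemma continuum_pairing : [set: set (nat * nat)] #<= [set: continuum].
Proof.
have := @card_le_set _ nat [set: nat * nat] (countableP _).
by apply: card_le_trans; apply: subset_card_le => K _ x.
Qed.

(** Cantor's diagonal argument. *)
Lemma small_countable (T : Type) (A : set T) : countable A -> small A.
Proof.
move=> Acount; apply/negP => /card_le_trans/(_ Acount).
move=> /card_le_injective[g ginj _].
pose D : set nat := [set n | exists2 K, g K = n & ~ K n].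
have [K gK nK] : exists2 K, g K = g D & ~ K (g D).
  apply: contrapT => nD.
  by case: (pselect (D (g D))) => DD; apply: nD => //; exists D.
by apply: (nK); rewrite (ginj _ _ gK); exists K.
Qed.

(** The diagonal argument of Koenig's theorem. The hypothesis on [e] says that
    there are at most continuum many functions from [I] to the continuum; it is
    available for countable [I] without further assumption, and for every small
    [I] once [2 ^ (< c) = c]. *)
Lemma konig_avoid (T : Type) (I : set T) (F : T -> set continuum)
    (e : continuum -> T -> continuum) :
  (forall h, exists a, forall i, I i -> e a i = h i) ->
  (forall i, I i -> small (F i)) ->
  exists a, forall i, I i -> ~ F i a.
Proof.
move=> esurj Fsmall.
have /choice[h hP] i : exists c, I i -> forall a, F i a -> e a i <> c.
  case: (pselect (I i)) => [Ii|nIi]; last by exists set0.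
  apply: contrapT => /forallNP noc; apply: not_small_continuum.
  apply: small_subset (small_image (fun a => e a i) (Fsmall i Ii)) => c _.
  apply: contrapT => nc; apply: (noc c) => _ a Fa eac.
  by apply: nc; exists a.
have [a ah] := esurj h.
by exists a => i Ii Fa; apply: (hP i Ii a Fa); exact: ah.
Qed.

Lemma small_bigcup_of_konig (S T : Type) (I : set S) (F : S -> set T)
    (e : continuum -> S -> continuum) :
  (forall h, exists a, forall i, I i -> e a i = h i) ->
  (forall i, I i -> small (F i)) -> small (\bigcup_(i in I) F i).
Proof.
move=> esurj Fsmall; apply/negP => /card_le_injective[g ginj gF].
have [i Ii|a aF] := @konig_avoid _ I (fun i => g @^-1` F i) e esurj.
  apply: small_card_le (Fsmall i Ii).
  by apply: (@injective_card_le _ _ _ _ g) => // x y _ _; exact: ginj.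
by have [i Ii Fga] := gF a; exact: (aF i Ii).
Qed.

Lemma card_le_enum (S : Type) (P : set S) (s0 : S) :
  P #<= [set: continuum] ->
  exists e : continuum -> S, forall s, P s -> exists a, e a = s.
Proof.
move=> Pc.
have /card_le_injective[g ginj _] : [set: set_type P] #<= [set: continuum].
  by rewrite (card_le_eql (card_setT P)).
exists (fun a => if pselect (exists s, g s = a) is left h
                 then val (sval (cid h)) else s0).
move=> s Ps; pose s' : set_type P := exist _ s (mem_set Ps).
exists (g s'); case: pselect => [h|[]]; last by exists s'.
by case: cid => t /= /ginj ->.
Qed.

(** A function from [I] to the power set of [nat] amounts to a subset of
    [I * nat]. *)
Lemma enum_functions (S : Type) (I : set S) :
  [set K : set (S * nat) | K `<=` I `*` [set: nat]] #<= [set: continuum] ->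
  exists e : continuum -> S -> continuum,
    forall h, exists a, forall i, I i -> e a i = h i.
Proof.
move=> /(card_le_enum set0)[e esurj].
exists (fun a i => [set n | e a (i, n)]) => h.
have [|a ea] := esurj [set x | I x.1 /\ h x.1 x.2]; first by move=> x [].
by exists a => i Ii; rewrite ea; apply/seteqP; split => n // [].
Qed.

Lemma enum_sequences :
  exists e : continuum -> nat -> continuum, forall h, exists a, e a = h.
Proof.
have [|e esurj] := @enum_functions nat setT.
  by apply: card_le_trans continuum_pairing; exact: card_leT.
exists e => h; have [a eah] := esurj h; exists a.
by apply/funext => n; exact: eah.
Qed.

(** Uncountable cofinality of the continuum: [I * nat] is a countable union of
    copies of [I]. This avoids the general fact that [I * nat] is equipotent to
    every infinite [I]. *)
Lemma small_setX_nat (S : Type) (I : set S) :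
  small I -> small (I `*` [set: nat]).
Proof.
move=> Ismall; have [e esurj] := enum_sequences.
have -> : I `*` [set: nat] = \bigcup_n (I `*` [set n]).
  by apply/seteqP; split=> [[s n] [Is _]|[s n] [m _ []]] //; exists n.
apply: (@small_bigcup_of_konig _ _ _ _ e) => [h|n _].
  by have [a <-] := esurj h; exists a.
apply: small_card_le Ismall; apply: (@injective_card_le _ _ _ _ fst).
  by move=> x [].
by move=> [s m] [t k] [_ /= ->] [_ /= ->] ->.
Qed.

Section WeakPower.
Hypothesis weak_power : is_weak_power continuum continuum.

(** This is [2 ^ #|D| <= c], once comparability of cardinals has turned not
    being at least [c] into being less than [c]. *)
Lemma card_small_powerset (T : Type) (D : set T) :
  small D -> [set K | K `<=` D] #<= [set: continuum].
Proof.
move=> Dsmall; pose L := set_type D.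
have LD : [set: L] #= D by exact: card_setT.
have nCL : ~~ ([set: continuum] #<= [set: L]) by rewrite (card_le_eqr LD).
have : [set: set L] #<= [set: continuum].
  apply: weak_power.1; exists L; last exact: card_eqxx.
  split; last by rewrite card_eq_le (negbTE nCL) andbF.
  by have [//|CL] := card_le_total L continuum; move: nCL; rewrite CL.
apply: card_le_trans; apply: card_le_set.
by rewrite (card_le_eqr LD) card_lexx.
Qed.

(** Regularity of the continuum. *)
Lemma small_bigcup (S T : Type) (I : set S) (F : S -> set T) :
  small I -> (forall i, I i -> small (F i)) -> small (\bigcup_(i in I) F i).
Proof.
move=> /small_setX_nat/card_small_powerset/enum_functions[e esurj].
exact: small_bigcup_of_konig esurj.
Qed.

Lemma small_setU (T : Type) (A B : set T) :
  small A -> small B -> small (A `|` B).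
Proof.
move=> As Bs; rewrite -bigcup2E; apply: small_bigcup.
  exact: small_countable.
by move=> [|[|n]] _ //=; apply: small_countable.
Qed.

Variable lt : continuum -> continuum -> Prop.
Hypothesis lt_total : forall x y, [\/ lt x y, x = y | lt y x].
Hypothesis small_below : forall x, small [set y | lt y x].

Lemma small_not_upper_bound (K : set continuum) :
  small K -> small [set b | exists2 a, K a & ~ lt a b].
Proof.
move=> Ks.
have := small_setU Ks (small_bigcup Ks (fun a _ => small_below a)).
apply: small_subset => b [a Ka nab].
by case: (lt_total a b) => // [<-|ba]; [left | right; exists a].
Qed.

(** Taking the bound inside a set [A] of full size replaces transitivity of
    [lt]. *)
Lemma small_bounded_in (A K : set continuum) :
  ~ small A -> small K -> exists2 b, A b & forall a, K a -> lt a b.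
Proof.
move=> Abig Ks; apply: contrapT => unbounded; apply: Abig.
apply: small_subset (small_not_upper_bound Ks) => b Ab.
apply: contrapT => nb; apply: unbounded; exists b => // a Ka.
by apply: contrapT => nab; apply: nb; exists a.
Qed.

Lemma small_bounded (K : set continuum) :
  small K -> exists b, forall a, K a -> lt a b.
Proof. by case/(small_bounded_in not_small_continuum) => b _; exists b. Qed.

End WeakPower.

(** * Counting small subsets and closing off *)

Lemma card_prod_continuum : [set: continuum * continuum] #<= [set: continuum].
Proof.
apply: card_le_trans continuum_pairing.
pose f (ab : continuum * continuum) : set (nat * nat) :=
  [set x | if x.1 == 0 then ab.1 x.2 else ab.2 x.2].
apply: (@injective_card_le _ _ _ _ f) => // -[a b] [c d] _ _ abcd.
congr pair; apply/seteqP; split => m abm.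
- by have : f (a, b) (0, m) by []; rewrite abcd.
- by have : f (c, d) (0, m) by []; rewrite -abcd.
- by have : f (a, b) (1, m) by []; rewrite abcd.
- by have : f (c, d) (1, m) by []; rewrite -abcd.
Qed.

Lemma card_sum_continuum (A B : Type) :
  [set: A] #<= [set: continuum] -> [set: B] #<= [set: continuum] ->
  [set: A + B] #<= [set: continuum].
Proof.
move=> /card_le_injective[f finj _] /card_le_injective[g ginj _].
apply: card_le_trans card_prod_continuum.
pose h (x : A + B) : continuum * continuum :=
  match x with inl a => (set0, f a) | inr b => (setT, g b) end.
have nT0 : ([set: nat] : continuum) <> set0.
  by move=> T0; have : [set: nat] 0 by []; rewrite T0.
apply: (@injective_card_le _ _ _ _ h) => // -[a|b] [a'|b'] _ _ [].
- by move/finj->.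
- by move/esym/nT0.
- by move/nT0.
- by move/ginj->.
Qed.

(** By regularity, a small subset of the continuum is bounded, hence a subset
    of one of [c] many initial segments, each of which has at most [c]
    subsets. *)
Lemma card_small_subsets (T : Type) :
  is_weak_power continuum continuum -> [set: T] #<= [set: continuum] ->
  [set K : set T | small K] #<= [set: continuum].
Proof.
move=> wp /card_le_injective[g ginj _].
have [lt [lt_wf lt_total small_below]] := exists_initial_order continuum.
have /choice[e eP] b : exists e : continuum -> set continuum,
    forall K, K `<=` [set a | lt a b] -> exists c, e c = K.
  apply: (card_le_enum set0).
  exact: (card_small_powerset wp (small_below b)).
apply: card_le_trans card_prod_continuum.
have sub : [set K : set T | small K] `<=`
    range (fun bc : continuum * continuum => g @^-1` e bc.1 bc.2).
  move=> K Ks.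
  have [b gKb] := small_bounded wp lt_total small_below (small_image g Ks).
  have [c ec] := eP b _ gKb; exists (b, c) => //=.
  by rewrite ec; apply/seteqP; split => [t [s Ks' /ginj <-]|t Kt] //; exists t.
exact: card_le_trans (subset_card_le sub) (card_image_le _ _).
Qed.

(** Closing off by bookkeeping. Each task [o] asks for an element of [op o f],
    a set that depends only on the values of [f] on a small set [supp o]. The
    function [t] assigns a task to every step, and each task to as many steps
    as there are indices; so every task occurs at a step that comes after its
    support, where all the data that it needs are known. *)
Lemma closing_off (X Op : Type) (supp : Op -> set continuum)
    (op : Op -> (continuum -> X) -> set X) (x0 : X) :
  is_weak_power continuum continuum ->
  [set: Op] #<= [set: continuum] ->
  (forall o, small (supp o)) ->
  (forall o f g, {in supp o, f =1 g} -> op o f = op o g) ->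
  exists f, forall o, op o f !=set0 -> exists a, op o f (f a).
Proof.
move=> wp Opc supp_small op_ext.
have [lt [lt_wf lt_total small_below]] := exists_initial_order continuum.
case: (pselect (exists o : Op, True)) => [[o0 _]|noOp]; last first.
  by exists (fun=> x0) => o; case: noOp; exists o.
have [t tP] : exists t : continuum -> Op, forall o, ~ small [set a | t a = o].
  have Opcc : [set: continuum * Op] #<= [set: continuum].
    have [g ginj _] := card_le_injective Opc.
    apply: card_le_trans card_prod_continuum.
    apply: (@injective_card_le _ _ _ _ (fun x => (x.1, g x.2))) => //.
    by move=> [a o] [c o'] _ _ [-> /ginj ->].
  have [t tsurj] := card_le_enum (set0 : continuum, o0) Opcc.
  exists (snd \o t) => o /(small_image (fst \o t)) osmall.
  apply: not_small_continuum; apply: small_subset osmall => c _.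
  by have [a ta] := tsurj (c, o) Logic.I; exists a; rewrite /= ta.
pose spec a f x := supp (t a) `<=` [set c | lt c a] ->
  op (t a) f !=set0 -> op (t a) f x.
have [||f fP] := @well_founded_choice _ _ lt spec x0 lt_wf.
- move=> a f g x fg fx suppa; rewrite -(op_ext _ f g) => [|c]; first exact: fx.
  by move=> /set_mem/suppa/fg.
- move=> a f; case: (pselect (op (t a) f !=set0)) => [[x opx]|no].
    by exists x.
  by exists x0 => _ /no.
exists f => o; have [a <- suppa] :=
  small_bounded_in wp lt_total small_below (@tP o) (supp_small o).
by move=> opx; exists a; exact: fP.
Qed.

(** * Pseudobases *)

Section Topology.
Variable X : topologicalType.
Hypothesis weak_power : is_weak_power continuum continuum.
Hypothesis X_hausdorff : hausdorff_space X.

Definition has_pseudobase (x : X) (L : Type) : Prop :=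
  exists2 U : L -> set X, forall i, open (U i) & \bigcap_i U i = [set x].

Lemma pseudobase_le (x : X) (K L : Type) :
  [set: K] #<= [set: L] -> has_pseudobase x K -> has_pseudobase x L.
Proof.
move=> /card_le_injective[g ginj _] [U Uopen Ux].
exists (fun l => if pselect (exists k, g k = l) is left h
                 then U (sval (cid h)) else setT) => [l|].
  by case: pselect => // _; exact: openT.
rewrite -Ux; apply/seteqP; split=> y yU k _; last first.
  by case: pselect => // h; exact: yU.
have := yU (g k) Logic.I; case: pselect => [h|[]]; last by exists k.
by case: cid => k' /= /ginj ->.
Qed.

(** The pseudocharacter of the space bounds that of a point only if the latter
    exists, that is, if some pseudobase at [x] has least cardinality. The set
    [N] of all open neighborhoods of [x] is a pseudobase. A minimal one
    exists among those indexed by subsets of [N], and this is enough: an index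
    type not larger than [N] is equipotent to a subset of [N]. *)
Lemma exists_point_pseudocharacter (x : X) :
  exists K, is_point_pseudocharacter x K.
Proof.
pose N := set_type [set A : set X | open A /\ A x].
have NP : has_pseudobase x N.
  exists val => [A|]; first by have [] := set_mem (valP A).
  apply/seteqP; split=> [y yN|_ -> A _]; last by have [] := set_mem (valP A).
  apply: contrapT => /eqP yx; rewrite eq_sym in yx.
  have [A [Aopen /set_mem Ax /set_mem nAy]] :=
    hausdorff_accessible X_hausdorff yx.
  by apply: nAy; apply: (yN (exist _ A (mem_set (conj Aopen Ax)))).
pose I := set_type [set S : set N | has_pseudobase x (set_type S)].
have subN (S : set N) : [set: set_type S] #= S by exact: card_setT.
have PT : has_pseudobase x (set_type [set: N]).
  by apply: pseudobase_le NP; rewrite (card_le_eqr (subN _)) card_lexx.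
pose i0 : I := exist _ [set: N] (mem_set PT).
have [i imin] := exists_least_card i0 (fun i => set_type (val i)).
have {}imin (S : set N) :
  has_pseudobase x (set_type S) -> [set: set_type (val i)] #<= S.
  move=> PS; have := imin (exist _ S (mem_set PS)).
  by rewrite (card_le_eqr (subN _)).
exists (set_type (val i)); split=> [|L PL]; first exact: set_mem (valP i).
have [NL|/card_le_injective[g ginj _]] := card_le_total N L.
  by apply: card_le_trans NL; exact: imin.
apply: card_le_trans (card_image_le g setT); apply: imin.
apply: pseudobase_le PL; rewrite (card_le_eqr (subN _)).
apply: (@injective_card_le _ _ _ _ g) => [l _|l l' _ _]; first by exists l.
exact: ginj.
Qed.

Lemma exists_pseudobases (psiX : Type) :
  is_pseudocharacter X psiX -> [set: psiX] #<= [set: continuum] ->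
  exists B : X -> continuum -> set X,
    (forall x c, open (B x c)) /\ forall x, \bigcap_c B x c = [set x].
Proof.
move=> [psi_ge _] psi_le.
have /choice[B BP] x : exists B : continuum -> set X,
    (forall c, open (B c)) /\ \bigcap_c B c = [set x].
  have [K Kpsi] := exists_point_pseudocharacter x.
  have [|B Bopen Bx] := @pseudobase_le x K continuum _ Kpsi.1; last by exists B.
  by apply: card_le_trans psi_le; apply: psi_ge; exists x.
by exists B; split=> [x|x]; have [] := BP x.
Qed.

(** * Saturated sets *)

(** The part of the space that is controlled by the points [f j], with [j] in
    [J], and the open sets [U j] attached to them. *)
Definition shadow (I : Type) (f : I -> X) (U : I -> set X) (J : set I) :
    set X :=
  closure (f @` J) `|` \bigcup_(j in J) U j.

Lemma eq_shadow (I : Type) (f g : I -> X) (U V : I -> set X) (J : set I) :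
  (forall j, J j -> f j = g j) -> (forall j, J j -> U j = V j) ->
  shadow f U J = shadow g V J.
Proof.
by move=> fg UV; congr (closure _ `|` _); [exact: eq_imagel|exact: eq_bigcupr].
Qed.

Lemma shadow_image (I I' : Type) (f : I' -> X) (U : I' -> set X) (h : I -> I')
    (J : set I) :
  shadow f U (h @` J) = shadow (f \o h) (U \o h) J.
Proof. by rewrite /shadow image_comp bigcup_image. Qed.

(** Two kinds of tasks are closed off at once: a sequence of indices asks for
    its limit, and a small set of pairs (index, member of the pseudobase) asks
    for a point outside of its shadow. A choice function [k] on a small [J] is
    handled by its graph. *)
Lemma exists_saturated_range (B : X -> continuum -> set X) (x0 : X) :
  exists f : continuum -> X,
    (forall (u : nat -> X) x,
       (forall n, range f (u n)) -> u @ \oo --> x -> range f x) /\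
    forall (J : set continuum) (k : continuum -> continuum), small J ->
      range f `<=` shadow f (fun j => B (f j) (k j)) J ->
      shadow f (fun j => B (f j) (k j)) J = setT.
Proof.
pose Small := set_type [set K : set (continuum * continuum) | small K].
pose supp (o : Small + (nat -> continuum)) : set continuum :=
  match o with inl K => fst @` val K | inr d => range d end.
pose op (o : Small + (nat -> continuum)) (f : continuum -> X) : set X :=
  match o with
  | inl K => ~` shadow (f \o fst) (fun jc => B (f jc.1) jc.2) (val K)
  | inr d => [set z | f \o d @ \oo --> z]
  end.
have Opc : [set: Small + (nat -> continuum)] #<= [set: continuum].
  apply: card_sum_continuum; last first.
    have [e esurj] := enum_sequences.
    have <- : range e = setT.
      by apply/seteqP; split=> // d _; have [a <-] := esurj d; exists a.
    exact: card_image_le.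
  rewrite (card_le_eql (card_setT _)); apply: card_small_subsets => //.
  exact: card_prod_continuum.
have [|o f g fg|f fP] := @closing_off X _ supp op x0 weak_power Opc.
- move=> [K|d] /=; first by apply: small_image; exact: set_mem (valP K).
  apply: small_countable; apply: card_le_trans (card_image_le _ _) _.
  exact: countableP.
- case: o fg => [K|d] fg /=.
    have fgK jc : val K jc -> f jc.1 = g jc.1.
      by move=> Kjc; apply: fg; apply/mem_set; exists jc.
    by congr (~` _); apply: eq_shadow => jc /fgK //= ->.
  suff -> : f \o d = g \o d by [].
  by apply/funext => n; apply: fg; apply/mem_set; exists n.
exists f; split=> [u x fu ux|J k J_small].
  have /choice[d du] n : exists c, f c = u n.
    by have [c _ <-] := fu n; exists c.
  have {du} uE : f \o d = u by exact/funext.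
  have [|a /= fa] := fP (inr d); first by exists x; rewrite /= uE.
  by exists a => //; apply: cvg_unique ux => //; rewrite -uE.
pose graph := (fun j => (j, k j)) @` J.
have graph_small : small graph by exact: small_image.
pose K : Small := exist _ graph (mem_set graph_small).
have opK : op (inl K) f = ~` shadow f (fun j => B (f j) (k j)) J.
  by rewrite /op shadow_image.
move=> f_shadow; apply/seteqP; split=> // z _; apply: contrapT => nz.
have [|a] := fP (inl K); first by exists z; rewrite opK.
by rewrite opK; apply; apply: f_shadow; exists a.
Qed.

(** * Closed sets in almost discretely Lindelof spaces *)

(** The point [f (xi b)] is picked outside of the shadow of the indices below
    [b] and of those already picked. The picked points form a discrete set:
    [U (xi a)] contains no later pick, and removing the closure of the earlier
    points makes it a neighborhood of [f (xi a)] without earlier picks. A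
    Lindelof subspace containing this set is covered by the complement of
    [range f] and the [U c]. *)
Lemma small_shadow_cover (f : continuum -> X) (U : continuum -> set X) :
  almost_discretely_lindelof X -> closed (range f) ->
  (forall a, open (U a)) -> (forall a, U a (f a)) ->
  exists2 J, small J & range f `<=` shadow f U J.
Proof.
move=> adl fclosed Uopen Uf; apply: contrapT => no_cover.
have avoid J : small J -> exists a, ~ shadow f U J (f a).
  move=> J_small; apply: contrapT => /forallNP covered; apply: no_cover.
  by exists J => // _ [a _ <-]; apply: contrapT; exact: covered.
have [lt [lt_wf lt_total small_below]] := exists_initial_order continuum.
pose prior (xi : continuum -> continuum) b :=
  [set a | lt a b] `|` xi @` [set a | lt a b].
have [||xi xiP] := @well_founded_choice continuum continuum lt
    (fun b xi a => ~ shadow f U (prior xi b) (f a)) set0 lt_wf.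
- move=> b xi xi' a xiE; suff -> : prior xi b = prior xi' b by [].
  by congr (_ `|` _); apply: eq_imagel => c; exact: xiE.
- move=> b xi; apply: avoid; apply: small_setU => //; first exact: small_below.
  by apply: small_image; exact: small_below.
have xi_notin_U b j : prior xi b j -> ~ U j (f (xi b)).
  by move=> bj Uj; apply: (xiP b); right; exists j.
pose D := range (f \o xi).
have Ddiscrete : discrete_space D.
  suff pt_open (d : D) : open [set d].
    move=> A; have <- : \bigcup_(d in A) [set d] = A.
      by apply/seteqP; split=> [d [_ Ad ->]|d Ad] //; exists d.
    by apply: bigcup_open => d _; exact: pt_open.
  have [a _ fa] : range (f \o xi) (val d) by exact: set_mem (valP d).
  exists (U (xi a) `&` ~` closure (f @` prior xi a)).
    by apply: openI => //; apply: closed_openC; exact: closed_closure.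
  apply/seteqP; split=> [d' /= [Ud' nd']|_ ->]; last first.
    split; rewrite /= set_valE -fa; first exact: Uf.
    by move=> cl_fa; apply: (xiP a); left.
  have [b _ fb] : range (f \o xi) (val d') by exact: set_mem (valP d').
  rewrite /= set_valE -fb in Ud' nd'; apply: val_inj; rewrite -fa -fb.
  case: (lt_total a b) => [ab|-> //|ba].
    by case: (@xi_notin_U b (xi a)) => //; right; exists a.
  by case: nd'; apply: subset_closure; exists (xi b) => //; right; exists b.
have [L Llin DL] := adl D Ddiscrete.
pose Cov : set (set L) :=
  [set V | exists2 W, W = ~` range f \/ exists c, W = U c & V = val @^-1` W].
have [V [W Wf ->]||C' [C'C C'count C'L]] := Llin Cov.
- exists W => //; case: Wf => [->|[c ->]] //.
  exact: closed_openC.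
- apply/seteqP; split=> // x _.
  case: (pselect (range f (val x))) => [[c _ fc]|nx].
    exists (val @^-1` U c); first by exists (U c) => //; right; exists c.
    by rewrite /= -fc; exact: Uf.
  by exists (val @^-1` ~` range f) => //; exists (~` range f) => //; left.
have /choice[n nP] : forall V : set L, exists c,
    C' V -> V = val @^-1` (~` range f) \/ V = val @^-1` (U c).
  move=> V; case: (pselect (C' V)) => [/C'C[W [->|[c ->]] ->]|nV].
  - by exists set0; left.
  - by exists c; right.
  - by exists set0.
have C's : small (n @` C') by apply: small_image; exact: small_countable.
have [b bP] := small_bounded weak_power lt_total small_below C's.
have Lb : f (xi b) \in L by apply/mem_set/DL; exists b.
have [V C'V Vb] : (\bigcup_(V in C') V) (exist _ (f (xi b)) Lb : L).
  by rewrite C'L.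
case: (nP V C'V) => VE; rewrite VE in Vb; first by apply: Vb; exists (xi b).
by apply: (@xi_notin_U b (n V)) => //; left; apply: bP; exists V.
Qed.

End Topology.

Theorem theorem8 (X : topologicalType) (psiX : Type) :
  is_weak_power continuum continuum ->
  hausdorff_space X ->
  sequential_space X ->
  almost_discretely_lindelof X ->
  is_pseudocharacter X psiX ->
  [set: psiX] #<= [set: continuum] ->
  [set: X] #<= [set: continuum].
Proof.
move=> wp hX seqX adl psi psi_le.
have [B [Bopen Bx]] := exists_pseudobases hX psi psi_le.
case: (pselect (exists x : X, True)) => [[x0 _]|noX]; last first.
  rewrite (_ : [set: X] = set0) ?card_ge0 //.
  by apply/seteqP; split=> // x _; apply: noX; exists x.
have [f [fseq fsat]] := exists_saturated_range wp hX B x0.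
have fclosed : closed (range f).
  apply: contrapT => /seqX[u [x [fu nx ux]]]; apply: nx; exact: fseq ux.
suff <- : range f = setT by exact: card_image_le.
apply/seteqP; split=> // p _; apply: contrapT => np.
have /choice[k kP] a : exists c, ~ B (f a) c p.
  apply: contrapT => /forallNP Bp; apply: np; exists a => //; apply/esym.
  have : (\bigcap_c B (f a) c) p by move=> c _; apply: contrapT; exact: Bp.
  by rewrite Bx.
have [//|a|J J_small] :=
    small_shadow_cover wp (U := fun a => B (f a) (k a)) adl fclosed.
  by have : [set f a] (f a) by []; rewrite -Bx; apply.
move=> /(fsat J k J_small) shadowT.
have : shadow f (fun j => B (f j) (k j)) J p by rewrite shadowT.
case=> [cl_p|[j _]]; last exact: kP.
by apply/np/fclosed; apply: closureS cl_p => _ [j _ <-]; exists j.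
Qed.
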